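(* Let $\Gamma$ be a finitely generated discrete group with the right-invariant word metric $d$. If the inclusion $C^*_r(\Gamma)\subseteq UC^*(\Gamma)$ (given by the left regular representation) is a nuclear map, then $\Gamma$, as the metric space $(\Gamma,d)$, is uniformly embeddable in a Hilbert space.
   Context: Fix a finite symmetric generating set of $\Gamma$ with word length $l$, and let $d(s,t)=l(st^{-1})$. The left regular representation $\lambda$ of $\Gamma$ on $\ell^2(\Gamma)$ is $\lambda_t\delta_r=\delta_{tr}$, where $\delta_r$ is the indicator of $r$; $C^*_r(\Gamma)$ is the norm closure of the span of $\{\lambda_t\}$ in $\mathcal{B}(\ell^2(\Gamma))$. A finite width operator is a function $A:\Gamma\times\Gamma\to\mathbb{C}$ that is bounded and for which there is $R>0$ with $A(s,t)=0$ whenever $d(s,t)>R$; it acts on $\ell^2(\Gamma)$ by $(A\xi)(s)=\sum_r A(s,r)\xi(r)$. The uniform Roe algebra $UC^*(\Gamma)$ is the norm closure in $\mathcal{B}(\ell^2(\Gamma))$ of the $*$-algebra of finite width operators; it contains $C^*_r(\Gamma)$. The inclusion $C^*_r(\Gamma)\to UC^*(\Gamma)$ is nuclear if there is a net $T_\lambda:C^*_r(\Gamma)\to UC^*(\Gamma)$ of finite rank, unital, completely positive linear maps with $\|T_\lambda(x)-x\|\to0$ for all $x\in C^*_r(\Gamma)$. A map $f$ from a metric space $(X,d)$ to a separable Hilbert space is a uniform embedding if there exist non-decreasing proper functions $\rho_\pm:[0,\infty)\to[0,\infty)$ with $\rho_-(d(x,y))\le\|f(x)-f(y)\|\le\rho_+(d(x,y))$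 for all $x,y$. *)

(* Defs.v *)
From HB Require Import structures.
From mathcomp Require Import all_boot all_order all_algebra.
From mathcomp Require Import complex.
From mathcomp Require Import boolp classical_sets reals constructive_ereal ereal
  topology normedtype sequences.

Set Implicit Arguments.
Unset Strict Implicit.
Unset Printing Implicit Defensive.

Import Order.TTheory GRing.Theory Num.Theory.
Local Open Scope ring_scope.
Local Open Scope complex_scope.

Record group (G : Type) := Group {
  gmul : G -> G -> G;
  ginv : G -> G;
  gone : G;
  gmulA : forall x y z, gmul x (gmul y z) = gmul (gmul x y) z;
  gmul1l : forall x, gmul gone x = x;
  gmul1r : forall x, gmul x gone = x;
  gmulVl : forall x, gmul (ginv x) x = gone;
  gmulVr : forall x, gmul x (ginv x) = gone
}.

Fixpoint inS {G : Type} (s : seq G) (g : G) : Prop :=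
  match s with nil => False | y :: s' => y = g \/ inS s' g end.

Section WordMetric.
Variables (G : Type) (Gr : group G).

Definition symmetric_set (S : seq G) : Prop :=
  forall s, inS S s -> inS S (ginv Gr s).

Definition is_word (S : seq G) (g : G) (n : nat) : Prop :=
  exists w : seq G, [/\ size w = n, (forall x, inS w x -> inS S x) &
                        foldr (gmul Gr) (gone Gr) w = g].

Definition generating (S : seq G) : Prop := forall g, exists n, is_word S g n.

Definition is_word_length (S : seq G) (l : G -> nat) : Prop :=
  forall g, is_word S g (l g) /\ (forall n, is_word S g n -> (l g <= n)%N).

Definition word_dist (l : G -> nat) (s t : G) : nat := l (gmul Gr s (ginv Gr t)).
End WordMetric.

(* Operators on l^2(Gamma), encoded by their matrix coefficients        *)
(*   A(s,t) = <A delta_t, delta_s>                                      *)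
Section Operators.
Variables (R : realType) (G : Type) (Gr : group G).
Local Notation C := (R[i]).

Definition Mat := G -> G -> C.

(* finitely supported vectors of l^2(G): formal sums of (point, coefficient);
   this is a dense subspace of l^2(G) *)
Definition fvec := seq (G * C).

Definition kron (s r : G) : C := if `[< s = r >] then 1 else 0.

(* <A xi, eta> = sum_s (A xi)(s) conj(eta s), with (A xi)(s) = sum_r A(s,r) xi(r) *)
Definition ip (A : Mat) (xi eta : fvec) : C :=
  \sum_(p <- eta) \sum_(q <- xi) (p.2)^* * A p.1 q.1 * q.2.

Definition idm : Mat := kron.

Definition sqnorm (xi : fvec) : C := ip idm xi xi.

(* ||A|| <= e  (for the bounded operator with matrix A); tested on the dense
   subspace of finitely supported vectors *)
Definition opnorm_le (A : Mat) (e : R) : Prop :=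
  forall xi eta : fvec,
    `|ip A xi eta| ^+ 2 <= (e ^+ 2)%:C * sqnorm xi * sqnorm eta.

Definition addm (A B : Mat) : Mat := fun s t => A s t + B s t.
Definition scalem (a : C) (A : Mat) : Mat := fun s t => a * A s t.
Definition subm (A B : Mat) : Mat := fun s t => A s t - B s t.

(* left regular representation: lambda_t delta_r = delta_{tr} *)
Definition lam (t : G) : Mat := fun s r => kron s (gmul Gr t r).

Definition lamcomb (c : seq (C * G)) : Mat :=
  fun s r => \sum_(p <- c) p.1 * lam p.2 s r.

Definition in_Cr (A : Mat) : Prop :=
  forall e : R, 0 < e -> exists c, opnorm_le (subm A (lamcomb c)) e.

Definition finite_width (d : G -> G -> nat) (A : Mat) : Prop :=
  (exists M : R, forall s t, `|A s t| <= M%:C) /\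
  (exists Rr : nat, forall s t, (Rr < d s t)%N -> A s t = 0).

Definition in_UC (d : G -> G -> nat) (A : Mat) : Prop :=
  forall e : R, 0 < e -> exists B, finite_width d B /\ opnorm_le (subm A B) e.

Definition pos_opmx (n : nat) (X : 'I_n -> 'I_n -> Mat) : Prop :=
  forall xi : 'I_n -> fvec, 0 <= \sum_(i < n) \sum_(j < n) ip (X i j) (xi j) (xi i).

Definition ucp_finite_rank (d : G -> G -> nat) (T : Mat -> Mat) : Prop :=
  [/\ (forall x, in_Cr x -> in_UC d (T x)),
      (forall (a : C) x y, in_Cr x -> in_Cr y ->
          T (addm (scalem a x) y) = addm (scalem a (T x)) (T y)),
      T idm = idm,
      (forall (n : nat) (X : 'I_n -> 'I_n -> Mat),
          (forall i j, in_Cr (X i j)) -> pos_opmx X ->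
          pos_opmx (fun i j => T (X i j))) &
      (exists bs : seq Mat, forall x, in_Cr x ->
          exists cs : seq C, size cs = size bs /\
            T x = (fun s t => \sum_(k < size bs) cs`_k * nth idm bs k s t))].

Definition nuclear_inclusion (d : G -> G -> nat) : Prop :=
  exists (I : Type) (le : I -> I -> Prop) (T : I -> Mat -> Mat),
    [/\ inhabited I,
        (forall i, le i i) /\ (forall i j k, le i j -> le j k -> le i k),
        (forall i j, exists k, le i k /\ le j k),
        (forall i, ucp_finite_rank d (T i)) &
        (forall x, in_Cr x -> forall e : R, 0 < e ->
           exists i0, forall i, le i0 i -> opnorm_le (subm (T i x) x) e)].
End Operators.

Section UnifEmb.
Variable R : realType.

Definition l2 (u : nat -> R) : Prop :=
  (\sum_(0 <= k <oo) ((u k ^+ 2)%:E) < +oo)%E.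

Definition l2dist2 (u v : nat -> R) : \bar R :=
  (\sum_(0 <= k <oo) (((u k - v k) ^+ 2)%:E))%E.

Definition nondecr_nonneg (rho : R -> R) : Prop :=
  (forall r, 0 <= r -> 0 <= rho r) /\
  (forall r s, 0 <= r -> r <= s -> rho r <= rho s).

Definition proper_fun (rho : R -> R) : Prop :=
  forall M : R, exists N : R, forall r, 0 <= r -> rho r <= M -> r <= N.

Definition uniform_embedding (X : Type) (d : X -> X -> nat) : Prop :=
  exists (f : X -> nat -> R) (rm rp : R -> R),
    [/\ (forall x, l2 (f x)),
        nondecr_nonneg rm /\ nondecr_nonneg rp, proper_fun rm, proper_fun rp &
        forall x y,
          ((rm (d x y)%:R) ^+ 2)%:E <= l2dist2 (f x) (f y) /\
          l2dist2 (f x) (f y) <= ((rp (d x y)%:R) ^+ 2)%:E]%E.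
End UnifEmb.

(* Main.v *)
Require Import Defs.
From mathcomp Require Import all_boot all_order all_algebra complex.
From mathcomp Require Import boolp classical_sets reals constructive_ereal ereal
  topology normedtype sequences.
From mathcomp Require Import ring lra.

Set Implicit Arguments.
Unset Strict Implicit.
Unset Printing Implicit Defensive.

Import Order.TTheory GRing.Theory Num.Theory.
Import numFieldNormedType.Exports.
Local Open Scope classical_set_scope.
Local Open Scope ring_scope.

(* For a unital completely positive T : C*_r -> UC*, the kernel
   u(s, t) = <T(lam_{s t^-1}) delta_t, delta_s> is positive definite, because the
   operator matrix (lam_{s_i s_j^-1}) is positive, and u(s, s) = 1.  If T is
   close to the identity on lam_g for g in a ball, then u is close to 1 near the
   diagonal.  If T has finite rank, the entries T(lam_g)(s, t) tend to 0 as
   d(s, t) grows, uniformly in g: the T(lam_g) form a bounded family in a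
   finite dimensional space of matrices decaying off the diagonal.  Taking such
   kernels u_n with 1 - Re u_n <= 2^-n when d <= n, the sum of the
   2 - 2 Re u_n is the squared distance of an embedding in a Hilbert space; its
   Gram kernel is factored by an infinite Cholesky decomposition along an
   enumeration of the group, which gives finitely supported vectors of l^2(N). *)

(** * Real positive kernels and their Cholesky factorisation *)

Section PositiveKernels.
Variables (R : realType) (X : Type).
Implicit Types (A : X -> X -> R) (s : seq (X * R)).

Definition qform A s := \sum_(p <- s) \sum_(q <- s) p.2 * q.2 * A p.1 q.1.

Definition psd A := (forall x y, A x y = A y x) /\ (forall s, 0 <= qform A s).

Lemma qform_cons A x c s : (forall x y, A x y = A y x) ->
  qform A ((x, c) :: s) =
  c ^+ 2 * A x x + 2 * c * (\sum_(p <- s) p.2 * A p.1 x) + qform A s.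
Proof.
move=> symA; rewrite /qform big_cons big_cons /=.
under [X in _ + X = _]eq_bigr do rewrite big_cons /=.
rewrite big_split /= mulr_sumr !addrA; congr (_ + _).
rewrite -!addrA; congr (_ + _); rewrite -big_split /=.
by apply: eq_bigr => p _; rewrite (symA x); ring.
Qed.

Lemma psd_diag_ge0 A x : psd A -> 0 <= A x x.
Proof.
by move=> [_ /(_ [:: (x, 1)])]; rewrite /qform !big_seq1 /= !mul1r.
Qed.

Lemma psd_diag_eq0 A x y : psd A -> A x x = 0 -> A y x = 0.
Proof.
move=> [symA posA] Axx; have [//|Ayx] := eqVneq (A y x) 0.
(* As [A x x = 0], the form is affine in the coefficient of [x]; this choice gives it the value
   -1. *)
have := posA [:: (x, - (1 + A y y) / (2 * A y x)); (y, 1)].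
rewrite !qform_cons // /qform !big_nil big_cons big_nil /= Axx.
have -> : 2 * (- (1 + A y y) / (2 * A y x)) * (1 * A y x + 0)
          = - (1 + A y y) by field.
lra.
Qed.

Lemma psd_diff_ge0 A x y : psd A -> 0 <= A x x - 2 * A x y + A y y.
Proof.
move=> [symA posA]; have := posA [:: (x, 1); (y, -1)].
by rewrite !qform_cons // /qform !big_nil big_cons big_nil /= (symA y); lra.
Qed.

Lemma psd_sum_ge0 A x y : psd A -> 0 <= A x x + 2 * A x y + A y y.
Proof.
move=> [symA posA]; have := posA [:: (x, 1); (y, 1)].
by rewrite !qform_cons // /qform !big_nil big_cons big_nil /= (symA y); lra.
Qed.

(** Schur complement: on a Gram kernel, it projects all vectors orthogonally to that of [z]. If
    [A z z = 0], division by zero gives 0 and [A] is unchanged. *)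
Definition schur A z x y := A x y - A x z * A y z / A z z.

Lemma schur_psd A z : psd A -> psd (schur A z).
Proof.
move=> pA; have [symA posA] := pA; split=> [x y|s].
  by rewrite /schur symA; ring.
pose B := \sum_(p <- s) p.2 * A p.1 z.
have -> : qform (schur A z) s = qform A s - B ^+ 2 / A z z.
  rewrite /qform expr2 {1}/B -mulrA mulr_suml -sumrB; apply: eq_bigr => p _.
  rewrite /B mulr_suml mulr_sumr -sumrB; apply: eq_bigr => q _.
  by rewrite /schur; ring.
have [Az|Az] := eqVneq (A z z) 0; first by rewrite Az invr0 mulr0 subr0.
(* This coefficient at [z] minimises the form of [A]; the minimum is the form of the Schur
   complement. *)
have := posA ((z, - B / A z z) :: s); rewrite qform_cons // -/B.
suff -> : (- B / A z z) ^+ 2 * A z z + 2 * (- B / A z z) * B + qform A s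
          = qform A s - B ^+ 2 / A z z by [].
by field.
Qed.

End PositiveKernels.

Section Cholesky.
Variables (R : realType) (A : nat -> nat -> R).
Hypothesis pA : psd A.

Fixpoint schur_iter n := if n is m.+1 then schur (schur_iter m) m else A.

Definition cholesky (i k : nat) :=
  schur_iter k i k / Num.sqrt (schur_iter k k k).

Lemma schur_iter_psd n : psd (schur_iter n).
Proof. by elim: n => //= n IH; apply: schur_psd. Qed.

(** Step [i] clears row [i], and later steps keep it zero. A zero pivot is harmless: by
    [psd_diag_eq0] its row is zero already. *)
Lemma schur_iter_eq0 n i j : (i < n)%N -> schur_iter n i j = 0.
Proof.
elim: n i j => //= n IH i j; rewrite ltnS leq_eqVlt => /orP[/eqP ->|lin].
  have pn := schur_iter_psd n; rewrite /schur.
  have [d0|d0] := eqVneq (schur_iter n n n) 0.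
    by rewrite d0 invr0 mulr0 subr0 (proj1 pn) (psd_diag_eq0 _ pn).
  by rewrite mulrAC divff // mul1r (proj1 pn) subrr.
by rewrite /schur !(IH i) // !mul0r subr0.
Qed.

Lemma cholesky_eq0 i k : (i < k)%N -> cholesky i k = 0.
Proof. by move=> ik; rewrite /cholesky schur_iter_eq0 // mul0r. Qed.

Lemma cholesky_gram n i j : (i < n)%N ->
  \sum_(0 <= k < n) cholesky i k * cholesky j k = A i j.
Proof.
(* Invariant of the elimination: the remainder after [n] steps is [schur_iter n], whose row [i]
   vanishes once [i < n]. *)
move=> lin; suff -> : A i j =
    \sum_(0 <= k < n) cholesky i k * cholesky j k + schur_iter n i j.
  by rewrite schur_iter_eq0 // addr0.
elim: {lin}n => [|n IH]; first by rewrite big_geq // add0r.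
rewrite big_nat_recr //= IH /schur -!addrA; congr (_ + _).
have d0 := psd_diag_ge0 n (schur_iter_psd n).
rewrite /cholesky -[X in _ = _ + (_ - _ / X)](sqr_sqrtr d0).
set r := Num.sqrt _; have [->|r0] := eqVneq r 0.
  by rewrite expr0n /= invr0 !mulr0 subr0 add0r.
by field.
Qed.

End Cholesky.

Lemma l2dist2_finite_support (R : realType) (u v : nat -> R) n :
  (forall k, (n <= k)%N -> u k = 0) -> (forall k, (n <= k)%N -> v k = 0) ->
  l2dist2 u v = (\sum_(0 <= k < n) (u k - v k) ^+ 2)%:E.
Proof.
move=> u0 v0; rewrite /l2dist2; apply: lim_near_cst => //.
exists n => // m /= nm; rewrite (big_cat_nat (n := n)) //= -sumEFin.
rewrite [X in (_ + X)%E]big1_seq ?adde0 // => k /andP[_].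
by rewrite mem_index_iota => /andP[nk _]; rewrite u0 // v0 // subrr expr0n.
Qed.

(* Cholesky factorisation along an enumeration of X: row x of the factor has
   only finitely many nonzero entries, so its square-summability is automatic. *)
Lemma psd_gram (R : realType) (X : Type) (e : nat -> X) (A : X -> X -> R) :
  (forall x, exists n, e n = x) -> psd A ->
  exists f : X -> nat -> R, (forall x, l2 (f x)) /\
    (forall x y, l2dist2 (f x) (f y) = (A x x - 2 * A x y + A y y)%:E).
Proof.
move=> /choice[idx idxK] [symA posA].
pose B i j := A (e i) (e j).
have pB : psd B.
  split=> [i j|s]; first exact: symA.
  have := posA [seq (e p.1, p.2) | p <- s].
  by rewrite /qform big_map; under eq_bigr do rewrite big_map.
exists (fun x => cholesky B (idx x)).
have dist x y : l2dist2 (cholesky B (idx x)) (cholesky B (idx y)) =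
    (A x x - 2 * A x y + A y y)%:E.
  pose n := (maxn (idx x) (idx y)).+1.
  have ltx : (idx x < n)%N by rewrite ltnS leq_maxl.
  have lty : (idx y < n)%N by rewrite ltnS leq_maxr.
  rewrite (@l2dist2_finite_support _ _ _ n) => [|k nk|k nk]; first last.
  - by rewrite cholesky_eq0 // (leq_trans lty).
  - by rewrite cholesky_eq0 // (leq_trans ltx).
  have := cholesky_gram pB (idx x) ltx; have := cholesky_gram pB (idx y) ltx.
  have := cholesky_gram pB (idx y) lty; rewrite /B !idxK => <- <- <-.
  congr EFin; rewrite mulr_sumr -sumrB -big_split /=.
  by apply: eq_bigr => k _; ring.
split=> // x; rewrite /l2.
have := @l2dist2_finite_support R (cholesky B (idx x)) (fun=> 0) (idx x).+1.
rewrite /l2dist2; under eq_eseriesr do rewrite subr0.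
by move=> ->// *; [rewrite ltry|rewrite cholesky_eq0].
Qed.

(** * Embedding from a sequence of kernels *)

Section KernelEmbedding.
Variables (R : realType) (X : Type) (d : X -> X -> nat).
Variables (w : nat -> X -> X -> R) (N : nat -> nat).
Hypotheses (w_psd : forall n, psd (w n)) (w_diag : forall n x, w n x x = 1).
Hypothesis w_near : forall n x y, (d x y <= n)%N -> 1 - w n x y <= 2^-1 ^+ n.
Hypothesis w_far : forall n x y, (N n < d x y)%N -> w n x y <= 2^-1.

(** Squared distance between the unit vectors whose Gram kernel is [w n]. *)
Definition kdist n x y := 2 - 2 * w n x y.

Definition ksum k x y := \sum_(0 <= n < k) kdist n x y.

Definition klim x y := limn (fun k => ksum k x y).

Lemma kdist_ge0 n x y : 0 <= kdist n x y.
Proof.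
by have := psd_diff_ge0 x y (w_psd n); rewrite /kdist !w_diag; lra.
Qed.

Lemma kdist_le4 n x y : kdist n x y <= 4.
Proof.
by have := psd_sum_ge0 x y (w_psd n); rewrite /kdist !w_diag; lra.
Qed.

Lemma ksum_nondecreasing x y : nondecreasing_seq (fun k => ksum k x y).
Proof.
apply/nondecreasing_seqP => n.
by rewrite /ksum big_nat_recr //= lerDl kdist_ge0.
Qed.

Lemma ksum_le k x y : ksum k x y <= 4 * (d x y)%:R + 4.
Proof.
(* The first [d x y] terms are at most 4 each, the later ones at most [2 * 2^-1 ^+ n]. The
   correction [4 * 2^-1 ^+ k] is the geometric tail still to come, which lets the induction
   close. *)
have : ksum k x y <= 4 * (minn k (d x y))%:R + 4 - 4 * 2^-1 ^+ k.
  elim: k => [|k IH].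
    by rewrite /ksum big_geq // min0n expr0; lra.
  rewrite /ksum big_nat_recr //= -/(ksum k x y) exprS.
  have [kd|dk] := ltnP k (d x y).
    have -> : minn k.+1 (d x y) = (minn k (d x y)).+1.
      by rewrite (minn_idPl kd) (minn_idPl (ltnW kd)).
    rewrite -natr1; have := kdist_le4 k x y.
    have : 0 <= 2^-1 ^+ k :> R by rewrite exprn_ge0 // invr_ge0.
    lra.
  rewrite (minn_idPr (leqW dk)) (minn_idPr dk) in IH *.
  by have := w_near dk; rewrite /kdist; lra.
have : (minn k (d x y))%:R <= (d x y)%:R :> R by rewrite ler_nat geq_minr.
have : 0 <= 2^-1 ^+ k :> R by rewrite exprn_ge0 // invr_ge0.
lra.
Qed.

Lemma ksum_cvg x y : cvgn (fun k => ksum k x y).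
Proof.
apply: nondecreasing_is_cvgn; first exact: ksum_nondecreasing.
by exists (4 * (d x y)%:R + 4) => _ [k _ <-]; apply: ksum_le.
Qed.

Lemma ksum_le_klim k x y : ksum k x y <= klim x y.
Proof.
exact: nondecreasing_cvgn_le (@ksum_nondecreasing x y) (@ksum_cvg x y) k.
Qed.

Lemma klim_le x y : klim x y <= 4 * (d x y)%:R + 4.
Proof.
apply: limr_le; first exact: ksum_cvg.
by apply: nearW => k; apply: ksum_le.
Qed.

Lemma klim_diag x : klim x x = 0.
Proof.
apply: lim_near_cst => //; apply: nearW => k.
by rewrite /ksum big1 // => n _; rewrite /kdist w_diag; ring.
Qed.

Lemma klim_sym x y : klim x y = klim y x.
Proof.
rewrite /klim; congr (limn _); apply/funext => k; rewrite /ksum.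
by apply: eq_bigr => n _; rewrite /kdist (proj1 (w_psd n)).
Qed.

(** At distance [m], each counted index adds at least 1 to [klim]. The cutoff at [m] keeps the count
    finite even if [N] is bounded. *)
Definition far_count m : nat := count (fun n => (N n < m)%N) (iota 0 m).

Lemma far_count_homo : {homo far_count : m n / (m <= n)%N}.
Proof.
move=> m n mn; rewrite /far_count -(subnKC mn) iotaD count_cat.
apply: leq_trans (leq_addr _ _); apply: sub_count => k /= /leq_trans; apply.
exact: leq_addr.
Qed.

Lemma far_count_unbounded K : exists m, (K <= far_count m)%N.
Proof.
(* This [m] is at least [K] and exceeds [N n] for all [n < K], so the first [K] indices are all
   counted. *)
pose m := (maxn K (\max_(n < K) (N n).+1))%N; exists m.
have Km : (K <= m)%N by apply: leq_maxl.
rewrite /far_count -(subnKC Km) iotaD count_cat.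
apply: leq_trans (leq_addr _ _); rewrite subnKC //.
rewrite -{1}(size_iota 0 K) -(count_predT (iota 0 K)) leq_eqVlt.
apply/orP; left.
apply/eqP/eq_in_count => n; rewrite mem_iota /= add0n => nK.
apply/esym; rewrite /m; apply: leq_trans (leq_maxr _ _).
exact: (@leq_bigmax _ (fun n : 'I_K => (N n).+1) (Ordinal nK)).
Qed.

Lemma far_count_le_klim x y : (far_count (d x y))%:R <= klim x y.
Proof.
apply: le_trans (ksum_le_klim (d x y) x y).
rewrite /far_count -sum1_count natr_sum /ksum /index_iota subn0.
rewrite big_mkcond /=; apply: ler_sum => n _.
case: ifP => [|_]; last exact: kdist_ge0.
by move/w_far; rewrite /kdist; lra.
Qed.

(** Polarisation: if [klim x y] is the squared distance of [v_x] and [v_y], this is the inner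
    product of [v_x - v_o] and [v_y - v_o]. *)
Definition gram o x y := (klim x o + klim y o - klim x y) / 2.

Lemma gram_psd o : psd (gram o).
Proof.
split=> [x y|s]; first by rewrite /gram (klim_sym x y); ring.
pose A k x y := (ksum k x o + ksum k y o - ksum k x y) / 2.
have cA x y : A k x y @[k --> \oo] --> gram o x y.
  apply: cvgMr_tmp; apply: cvgB; last exact: ksum_cvg.
  by apply: cvgD; apply: ksum_cvg.
(* For fixed [s] the form is a finite sum, hence continuous in the entries, so positivity passes to
   the limit. *)
have cQ : qform (A k) s @[k --> \oo] --> qform (gram o) s.
  rewrite /qform; apply: cvg_big => [|p _]; first exact: add_continuous.
  apply: cvg_big => [|q _]; first exact: add_continuous.
  exact: cvgMl_tmp.
rewrite -(cvg_lim _ cQ) //; apply: limr_ge.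
  by apply/cvg_ex; exists (qform (gram o) s).
apply: nearW => k.
(* A k is the Gram kernel of the differences v_x - v_o, so its quadratic form
   is that of the w n, with the extra mass - c at o. *)
pose c := \sum_(p <- s) p.2.
suff -> : qform (A k) s = \sum_(0 <= n < k) qform (w n) ((o, - c) :: s).
  by rewrite sumr_ge0 // => n _; apply: (proj2 (w_psd n)).
have EA x y : A k x y = \sum_(0 <= n < k) (1 - w n x o - w n y o + w n x y).
  rewrite /A /ksum -big_split -sumrB mulr_suml /=; apply: eq_bigr => n _.
  by rewrite /kdist; field.
rewrite /qform; under eq_bigr => p _ do under eq_bigr => q _ do
  rewrite EA mulr_sumr.
under eq_bigr do rewrite exchange_big.
rewrite exchange_big /=; apply: eq_bigr => n _.
rewrite -/(qform (w n) ((o, - c) :: s)) qform_cons ?w_diag;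
  last exact: (proj1 (w_psd n)).
set B := \sum_(p <- s) p.2 * w n p.1 o.
have -> : (- c) ^+ 2 * 1 + 2 * - c * B + qform (w n) s =
  c * c - B * c - c * B + qform (w n) s by ring.
rewrite /qform /c /B !big_distrlr -!sumrB -big_split; apply: eq_bigr => p _ /=.
rewrite -!sumrB -big_split; apply: eq_bigr => q _ /=.
by ring.
Qed.

Lemma uniform_embedding_of_kernels (e : nat -> X) :
  (forall x, exists n, e n = x) -> uniform_embedding R d.
Proof.
move=> esurj; have [f [fl2 fdist]] := psd_gram esurj (gram_psd (e 0)).
have fE x y : l2dist2 (f x) (f y) = (klim x y)%:E.
  by rewrite fdist /gram !klim_diag; congr EFin; field.
(* Square roots, because [klim] is a squared distance; [truncn] extends the count to real
   arguments. *)
pose rm (r : R) := Num.sqrt (far_count (Num.truncn r))%:R : R.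
pose rp (r : R) := Num.sqrt (4 * r + 4).
exists f, rm, rp; split; first exact: fl2.
- split; split=> [r _|r s r0 rs]; rewrite ?sqrtr_ge0 //; apply: ler_wsqrtr.
    by rewrite ler_nat; apply/far_count_homo/le_truncn.
  lra.
(* The count at [m] exceeds [M ^+ 2], hence [rm r > M] from [m] on. *)
- move=> M; have [m Km] := far_count_unbounded (Num.truncn (M ^+ 2)).+1.
  exists m%:R => r r0 rM; rewrite leNgt; apply/negP => mr.
  have mr' : (m <= Num.truncn r)%N by rewrite -(@natrK R m) le_truncn // ltW.
  have := leq_trans Km (far_count_homo mr').
  rewrite -(@ler_nat R) => H; have := truncnS_gt (M ^+ 2).
  have : rm r ^+ 2 <= M ^+ 2.
    by rewrite ler_sqr ?nnegrE ?sqrtr_ge0 // (le_trans _ rM) ?sqrtr_ge0.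
  rewrite sqr_sqrtr ?ler0n //; lra.
- move=> M; exists (M ^+ 2) => r r0 rM.
  have : rp r ^+ 2 <= M ^+ 2.
    by rewrite ler_sqr ?nnegrE ?sqrtr_ge0 // (le_trans _ rM) ?sqrtr_ge0.
  by rewrite sqr_sqrtr; lra.
- move=> x y; rewrite fE !lee_fin /rm /rp !sqr_sqrtr ?natrK ?ler0n //.
  by split; [exact: far_count_le_klim | exact: klim_le].
Qed.

End KernelEmbedding.

(** * Uniform decay of bounded finite rank families *)

Section UniformDecay.
Variables (K : numFieldType) (P : Type) (h : P -> nat).

Definition decays (f : P -> K) := forall e : K, 0 < e ->
  exists n : nat, forall p, (n < h p)%N -> `|f p| <= e.

(* Induction on the dimension of the span: subtracting multiples of one F i0
   with F i0 p0 != 0 makes the whole family vanish at p0. *)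
Lemma bounded_finite_rank_decays_uniformly (I : Type) m (b : 'I_m -> P -> K)
    (F : I -> P -> K) (M : K) :
  (forall i, exists c : 'I_m -> K, forall p, F i p = \sum_k c k * b k p) ->
  (forall i p, `|F i p| <= M) -> (forall i, decays (F i)) ->
  forall e : K, 0 < e ->
  exists n : nat, forall i p, (n < h p)%N -> `|F i p| <= e.
Proof.
elim: m b F M => [|m IH] b F M Fspan Fbnd Fdec e e0.
  exists 0%N => i p _; have [c ->] := Fspan i.
  by rewrite big_ord0 normr0 ltW.
have [[i0 [p0 F0]]|F0] := pselect (exists i p, F i p != 0); last first.
  exists 0%N => i p _; have [->|Fip] := eqVneq (F i p) 0;
    last by case: F0; exists i, p.
  by rewrite normr0 ltW.
have [k bk0] : exists k, b k p0 != 0.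
  have [c Fc] := Fspan i0; apply: contrapT => nb; move/eqP: F0; apply.
  rewrite Fc big1 // => k _; have [->|bk] := eqVneq (b k p0) 0;
    first exact: mulr0.
  by case: nb; exists k.
pose q := M / `|F i0 p0|.
have q0 : 0 <= q by rewrite divr_ge0 // (le_trans _ (Fbnd i0 p0)).
have qle i : `|F i p0 / F i0 p0| <= q.
  by rewrite normf_div ler_wpM2r // invr_ge0.
(* Both [b'] and [F'] vanish at [p0]; [b'] has one generator fewer, [b k] being used to correct the
   others. *)
pose b' j p := b (lift k j) p - b (lift k j) p0 / b k p0 * b k p.
pose F' i p := F i p - F i p0 / F i0 p0 * F i0 p.
(* The multipliers are bounded by [q] for all [i], so the decay of the single [F i0] controls every
   subtracted term at once. *)
have small eps : 0 < eps -> exists n : nat, forall i p, (n < h p)%N ->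
    `|F i p0 / F i0 p0 * F i0 p| <= eps / 2.
  move=> eps0; have q1 : 0 < q + 1 by rewrite ltr_wpDl.
  have eps2 : 0 < eps / 2 by rewrite divr_gt0.
  have [n Hn] := Fdec i0 (eps / 2 / (q + 1)) (divr_gt0 eps2 q1).
  exists n => i p /Hn Fp; rewrite normrM.
  apply: le_trans (ler_pM _ _ (qle i) Fp) _ => //.
  by rewrite mulrCA ler_piMr ?ltW // ltr_pdivrMr // mul1r ltrDl.
have F'span i : exists c : 'I_m -> K, forall p, F' i p = \sum_k c k * b' k p.
  have [ci Fci] := Fspan i; have [c0 Fc0] := Fspan i0.
  pose c k := ci k - F i p0 / F i0 p0 * c0 k.
  have Fc p : F' i p = \sum_k c k * b k p.
    rewrite /F' Fci (Fc0 p) mulr_sumr -sumrB; apply: eq_bigr => j _.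
    by rewrite /c; ring.
  exists (fun j => c (lift k j)) => p.
  have F'p0 : F' i p0 = 0 by rewrite /F'; field.
  move: (Fc p0) (Fc p); rewrite F'p0 !(bigD1_ord k) //=.
  set S := \sum_(_ < m) _ => /esym/eqP; rewrite addr_eq0 => /eqP ck.
  (* Vanishing at [p0] determines the coefficient of [b k] from the others, which puts [F' i] in the
     span of [b']. *)
  have {}ck : c k = - S / b k p0 by rewrite -ck mulfK.
  move=> ->; rewrite ck /b'.
  under [RHS]eq_bigr do rewrite mulrBr.
  rewrite sumrB addrC; congr (_ + _).
  rewrite mulNr mulNr; congr (- _); rewrite /S !mulr_suml.
  by apply: eq_bigr => j _; ring.
have F'bnd i p : `|F' i p| <= M + q * M.
  by apply: le_trans (ler_normB _ _) _; rewrite lerD // normrM ler_pM.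
have F'dec i : decays (F' i).
  move=> eps eps0; have eps2 : 0 < eps / 2 by rewrite divr_gt0.
  have [n1 Hn1] := Fdec i _ eps2; have [n2 Hn2] := small _ eps0.
  exists (maxn n1 n2) => p; rewrite gtn_max => /andP[/Hn1 h1 /(Hn2 i) h2].
  by apply: le_trans (ler_normB _ _) _; rewrite [leRHS]splitr lerD.
have e2 : 0 < e / 2 by rewrite divr_gt0.
have [n1 Hn1] := IH b' F' _ F'span F'bnd F'dec _ e2.
have [n2 Hn2] := small _ e0.
exists (maxn n1 n2) => i p; rewrite gtn_max => /andP[/(Hn1 i) h1 /(Hn2 i) h2].
have -> : F i p = F' i p + F i p0 / F i0 p0 * F i0 p by rewrite /F' subrK.
by apply: le_trans (ler_normD _ _) _; rewrite [leRHS]splitr lerD.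
Qed.

End UniformDecay.

(** * Complex kernels and the left regular representation *)

Section ComplexKernels.
Variable R : realType.
Local Notation C := R[i].
Local Open Scope complex_scope.
Local Open Scope ring_scope.

(** There is no symmetry clause: [0 <= z] in [R[i]] makes [z] real, and this already forces
    Hermitian symmetry. *)
Definition cpsd (X : Type) (K : X -> X -> C) := forall s : seq (X * C),
  0 <= \sum_(p <- s) \sum_(q <- s) (p.2)^* * K p.1 q.1 * q.2.

Lemma Re_sum (I : Type) (s : seq I) (F : I -> C) :
  complex.Re (\sum_(i <- s) F i) = \sum_(i <- s) complex.Re (F i).
Proof. by apply: (big_morph (@complex.Re R)) => // -[a b] [c d]. Qed.

Section UnitDiagonal.
Variables (X : Type) (K : X -> X -> C).
Hypotheses (pK : cpsd K) (K1 : forall x, K x x = 1).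

Lemma cpsd_pair x y (b : C) :
  0 <= 1 + conjc b * b + K x y * b + conjc b * K y x.
Proof.
have := pK [:: (x, 1); (y, b)]; rewrite -[conjc b]/(b^* ).
rewrite !big_cons !big_nil !K1 rmorph1 /= !addr0 !mulr1 !mul1r.
by congr (0 <= _); ring.
Qed.

Lemma cpsd_Re_psd : psd (fun x y => complex.Re (K x y)).
Proof.
split=> [x y|s].
  have := cpsd_pair x y 1; have := cpsd_pair x y 'i%C.
  case: (K x y) => a b; case: (K y x) => a' b'; rewrite !lecE /=.
  by move=> /andP[/eqP h1 _] _; lra.
have := pK [seq (p.1, p.2%:C) | p <- s]; rewrite lecE => /andP[_].
rewrite /qform big_map Re_sum /=; congr (0 <= _).
apply: eq_bigr => p _; rewrite big_map Re_sum; apply: eq_bigr => q _ /=.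
by case: (K _ _) => a b /=; ring.
Qed.

(** Testing pairs with coefficients 1 and a fourth root of unity bounds the real and imaginary parts
    by 1. The sharp bound is 1, but any uniform constant serves. *)
Lemma cpsd_norm_le x y : `|K x y| <= 2.
Proof.
have [re1 im1] : `|complex.Re (K x y)| <= 1 /\ `|complex.Im (K x y)| <= 1.
  have := cpsd_pair x y 1; have := cpsd_pair x y (-1).
  have := cpsd_pair x y 'i%C; have := cpsd_pair x y (- 'i%C).
  case: (K x y) => a b; case: (K y x) => a' b'; rewrite !lecE /=.
  move=> /andP[/eqP i1 r1] /andP[/eqP i2 r2].
  move=> /andP[/eqP i3 r3] /andP[/eqP i4 r4].
  by rewrite !ler_norml; split; lra.
rewrite normc_def -[2](rmorph_nat (real_complex R)) lecR.
rewrite -[leRHS]ger0_norm // -sqrtr_sqr ler_wsqrtr //.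
rewrite -[_ ^+ 2]real_normK ?num_real // -[X in _ + X]real_normK ?num_real //.
have := expr_le1 (n := 2) isT (normr_ge0 (complex.Re (K x y))).
have := expr_le1 (n := 2) isT (normr_ge0 (complex.Im (K x y))).
by rewrite re1 im1; lra.
Qed.

End UnitDiagonal.

(** Grouping the coefficients by point turns the form into a sum of squared moduli. *)
Lemma delta_cpsd (X : eqType) : cpsd (fun x y : X => (x == y)%:R : C).
Proof.
move=> s; pose u := undup (map fst s).
have -> : \sum_(p <- s) \sum_(q <- s) (p.2)^* * (p.1 == q.1)%:R * q.2 =
    \sum_(k <- u) (\sum_(p <- s) (p.1 == k)%:R * p.2)^* *
                  (\sum_(q <- s) (q.1 == k)%:R * q.2).
  under [RHS]eq_bigr do rewrite rmorph_sum big_distrlr /=.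
  rewrite [RHS]exchange_big [LHS]big_seq_cond [RHS]big_seq_cond /=.
  apply: eq_bigr => p /andP[ps _]; rewrite [RHS]exchange_big.
  apply: eq_bigr => q _ /=.
  have pu : p.1 \in u by rewrite mem_undup; apply: map_f.
  rewrite (bigD1_seq p.1) ?undup_uniq //= big1 ?addr0 => [|k /negbTE kp].
    by rewrite eqxx mul1r -mulrA eq_sym.
  by rewrite eq_sym kp mul0r rmorph0 mul0r.
by rewrite sumr_ge0 // => k _; rewrite mulrC mul_conjC_ge0.
Qed.

End ComplexKernels.

Section RegularRepresentation.
Variables (R : realType) (G : Type) (Gr : group G).
Local Notation C := R[i].
Local Notation "x ⋅ y" := (gmul Gr x y) (at level 40, left associativity).
Local Notation inv := (ginv Gr).
Local Open Scope complex_scope.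
Local Open Scope ring_scope.

Lemma kron_cpsd : cpsd (@kron R G).
Proof.
(* [{classic G}] supplies the decidable equality that [G] lacks. *)
move=> s; have := @delta_cpsd R {classic G} s; congr (0 <= _).
apply: eq_bigr => p _; apply: eq_bigr => q _; congr (_ * _ * _).
rewrite /kron; case: asboolP => [->|npq]; first by rewrite eqxx.
by have [/npq|] := eqVneq (p.1 : {classic G}) q.1.
Qed.

Lemma sqnorm_ge0 (xi : fvec R G) : 0 <= sqnorm xi.
Proof. exact: kron_cpsd. Qed.

Lemma ip_delta (A : Mat R G) s t a b :
  ip A [:: (t, b)] [:: (s, a)] = a^* * A s t * b.
Proof. by rewrite /ip !big_seq1. Qed.

Lemma opnorm_le_entry (A : Mat R G) (e : R) s t : 0 <= e ->
  opnorm_le A e -> `|A s t| <= e%:C.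
Proof.
move=> e0 /(_ [:: (t, 1)] [:: (s, 1)]).
have sq (x : G) : sqnorm [:: (x, 1 : C)] = 1.
  by rewrite /sqnorm ip_delta /idm /kron asboolT // rmorph1 !mulr1.
rewrite !sq ip_delta rmorph1 mul1r !mulr1 rmorphXn /= ler_sqr ?nnegrE //.
by rewrite lecR.
Qed.

Lemma lam_in_Cr g : in_Cr Gr (lam R Gr g).
Proof.
move=> e e0; exists [:: (1, g)] => xi eta.
have -> : ip (subm (lam R Gr g) (lamcomb Gr [:: (1, g)])) xi eta = 0.
  rewrite /ip big1 // => p _; rewrite big1 // => q _.
  by rewrite /subm /lamcomb big_seq1 mul1r subrr mulr0 mul0r.
rewrite normr0 expr0n /= !mulr_ge0 ?sqnorm_ge0 //.
by rewrite lecR sqr_ge0.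
Qed.

Lemma lam1 : lam R Gr (gone Gr) = @idm R G.
Proof. by apply/funext => s; apply/funext => t; rewrite /lam gmul1l. Qed.

(** This is the factorisation of the operator of [g h^-1] as that of [g] times the adjoint of that
    of [h], in coefficients. *)
Lemma lam_translate g h s t :
  lam R Gr (g ⋅ inv h) s t = kron R (inv g ⋅ s) (inv h ⋅ t).
Proof.
rewrite /lam /kron; congr (if _ then _ else _); apply: asbool_equiv_eq.
split=> [->|]; first by rewrite -gmulA gmulA gmulVl gmul1l.
move=> /(congr1 (gmul Gr g)).
by rewrite gmulA gmulVr gmul1l => ->; rewrite gmulA.
Qed.

(** The form is the squared norm of the sum of the [xi i] translated by [inv (g i)]; concatenating
    the formal sums [L i] represents that vector. *)
Lemma lam_pos n (g : 'I_n -> G) :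
  pos_opmx (fun i j => lam R Gr (g i ⋅ inv (g j))).
Proof.
move=> xi; pose L i := [seq (inv (g i) ⋅ p.1, p.2) | p <- xi i].
have := kron_cpsd (flatten [seq L i | i <- index_enum 'I_n]); congr (0 <= _).
rewrite big_flatten big_map; apply: eq_bigr => i _; rewrite big_map.
under eq_bigr do rewrite big_flatten big_map.
rewrite exchange_big; apply: eq_bigr => j _; apply: eq_bigr => p _.
rewrite big_map; apply: eq_bigr => q _.
by rewrite lam_translate.
Qed.

(** * Kernels of finite rank unital completely positive maps *)

Section UCP.
Variables (d : G -> G -> nat) (T : Mat R G -> Mat R G).
Hypothesis ucpT : ucp_finite_rank Gr d T.

(** Complete positivity is applied to the positive matrix of [lam_pos], tested on multiples of delta
    vectors. Pairs decouple the group element from the matrix position, as the entry bound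
    requires. *)
Lemma ucp_cpsd :
  cpsd (fun x y : G * G => T (lam R Gr (x.1 ⋅ inv y.1)) x.2 y.2).
Proof.
case: ucpT => _ _ _ posT _ s.
pose x0 := ((gone Gr, gone Gr), 0 : C).
pose x (i : 'I_(size s)) := nth x0 s i.
have := posT _ _ (fun i j => lam_in_Cr _) (lam_pos (fun i => (x i).1.1))
  (fun i => [:: ((x i).1.2, (x i).2)]).
rewrite (big_nth x0) big_mkord; congr (0 <= _); apply: eq_bigr => i _.
by rewrite (big_nth x0) big_mkord; apply: eq_bigr => j _; rewrite ip_delta.
Qed.

Lemma ucp_diag g s : T (lam R Gr (g ⋅ inv g)) s s = 1.
Proof.
by case: ucpT => _ _ T1 _ _; rewrite gmulVr lam1 T1 /idm /kron asboolT.
Qed.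

(** Evaluating the kernel at [(g, s)] and [(gone Gr, t)] gives a bound uniform in [g] without any
    norm estimate for [T]. *)
Lemma ucp_entry_le g s t : `|T (lam R Gr g) s t| <= 2.
Proof.
have := cpsd_norm_le ucp_cpsd (fun x => ucp_diag x.1 x.2) (g, s) (gone Gr, t).
have -> : (g, s).1 ⋅ inv (gone Gr, t).1 = g => //=.
by rewrite -[inv _](gmul1r Gr) gmulVl gmul1r.
Qed.

Lemma in_UC_decays (A : Mat R G) : in_UC d A ->
  decays (fun p => d p.1 p.2) (fun p : G * G => A p.1 p.2).
Proof.
move=> UA [e ie]; rewrite ltcE /= => /andP[/eqP -> e0].
have [B [[_ [n Bn]] AB]] := UA e e0; exists n => p dp.
have := opnorm_le_entry p.1 p.2 (ltW e0) AB.
by rewrite /subm Bn // subr0.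
Qed.

(** Uniformity in [g] is essential: in [ucp_kernel] the element [s t^-1] varies with the
    position. *)
Lemma ucp_decays_uniformly (e : R) : 0 < e ->
  exists n : nat, forall g s t, (n < d s t)%N -> `|T (lam R Gr g) s t| <= e%:C.
Proof.
move=> e0; case: (ucpT) => TUC _ _ _ [bs Tbs].
have eC : 0 < e%:C by rewrite ltcR.
have [||g|n Hn] := @bounded_finite_rank_decays_uniformly C (G * G)
  (fun p => d p.1 p.2) G (size bs) (fun k p => nth (@idm R G) bs k p.1 p.2)
  (fun g p => T (lam R Gr g) p.1 p.2) 2 _ _ _ _ eC.
- move=> g; have [cs [_ ->]] := Tbs _ (lam_in_Cr g).
  by exists (fun k => cs`_k).
- by move=> g p; apply: ucp_entry_le.
- exact/in_UC_decays/TUC/lam_in_Cr.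
by exists n => g s t dst; apply: (Hn g (s, t)).
Qed.

Definition ucp_kernel s t := complex.Re (T (lam R Gr (s ⋅ inv t)) s t).

Lemma ucp_kernel_psd : psd ucp_kernel.
Proof.
apply: (@cpsd_Re_psd R G (fun s t => T (lam R Gr (s ⋅ inv t)) s t)) => [s|s].
  have := ucp_cpsd [seq ((p.1, p.1), p.2) | p <- s].
  by rewrite big_map; under eq_bigr do rewrite big_map.
exact: ucp_diag.
Qed.

Lemma ucp_kernel_diag s : ucp_kernel s s = 1.
Proof. by rewrite /ucp_kernel ucp_diag. Qed.

Lemma ucp_kernel_near e s t : 0 <= e ->
  opnorm_le (subm (T (lam R Gr (s ⋅ inv t))) (lam R Gr (s ⋅ inv t))) e ->
  1 - ucp_kernel s t <= e.
Proof.
move=> e0 /(opnorm_le_entry s t e0); rewrite /subm {2}/lam.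
rewrite -gmulA gmulVl gmul1r /kron asboolT // => Tst.
have := le_trans (normc_ge_Re _) Tst.
rewrite lecR /ucp_kernel; case: (T _ s t) => a b /= ab.
by apply: le_trans ab; rewrite distrC ler_norm.
Qed.

Lemma ucp_kernel_far : exists n : nat, forall s t, (n < d s t)%N ->
  ucp_kernel s t <= 2^-1.
Proof.
have [|n Hn] := @ucp_decays_uniformly 2^-1; first by rewrite invr_gt0.
exists n => s t /(Hn (s ⋅ inv t)) /(le_trans (normc_ge_Re _)).
by rewrite lecR; apply: le_trans; apply: ler_norm.
Qed.

End UCP.
End RegularRepresentation.

(** * Word balls and the theorem *)

Section WordBalls.
Variables (G : Type) (Gr : group G) (S : seq G) (l : G -> nat).
Hypothesis wlen : is_word_length Gr S l.

Lemma inS_cat (s t : seq G) g : inS (s ++ t) g <-> inS s g \/ inS t g.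
Proof. by elim: s => /= [|x s IH]; tauto. Qed.

Lemma inS_map (f : G -> G) (s : seq G) g : inS s g -> inS (map f s) (f g).
Proof. by elim: s => //= x s IH [->|/IH]; [left|right]. Qed.

Lemma inS_allpairs (f : G -> G -> G) (s t : seq G) x y :
  inS s x -> inS t y -> inS (allpairs f s t) (f x y).
Proof.
elim: s => //= z s IH [->|sx] ty; apply/inS_cat; first by left; apply: inS_map.
by right; apply: IH.
Qed.

Lemma inS_nth (s : seq G) x0 x : inS s x -> exists k, nth x0 s k = x.
Proof.
elim: s => //= y s IH [->|/IH[k kE]]; first by exists 0%N.
by exists k.+1.
Qed.

(** A word is coded by the list of its letters' indices in [S], and such lists are countable.
    Naturals that code no list fall back to the empty word. *)
Lemma group_countable : exists e : nat -> G, forall g, exists n, e n = g.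
Proof.
pose ev (ks : seq nat) := foldr (gmul Gr) (gone Gr) (map (nth (gone Gr) S) ks).
exists (fun n => ev (odflt [::] (unpickle n))) => g.
have [[w [_ wS <-]] _] := wlen g.
have [ks ->] : exists ks, w = map (nth (gone Gr) S) ks.
  elim: w wS => [|x w IH] wS; first by exists [::].
  have [k kE] := inS_nth (gone Gr) (wS x (or_introl erefl)).
  have [ks ->] := IH (fun y wy => wS y (or_intror wy)).
  by exists (k :: ks); rewrite /= kE.
by exists (pickle ks); rewrite pickleK.
Qed.

Lemma words_finite n : exists B : seq G, forall g, is_word Gr S g n -> inS B g.
Proof.
elim: n => [|n [B HB]].
  by exists [:: gone Gr] => g [[|x w] [//= _ _ <-]]; left.
exists (allpairs (gmul Gr) S B) => g [[|x w] [//= [sw] wS <-]].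
apply: inS_allpairs; first by apply: wS; left.
by apply: HB; exists w; split=> // y wy; apply: wS; right.
Qed.

Lemma balls_finite n : exists B : seq G, forall g, (l g <= n)%N -> inS B g.
Proof.
elim: n => [|n [B HB]].
  have [B HB] := words_finite 0; exists B => g; rewrite leqn0 => /eqP lg.
  by apply: HB; rewrite -lg; apply: (proj1 (wlen g)).
have [B' HB'] := words_finite n.+1; exists (B ++ B') => g lg; apply/inS_cat.
have [/HB|nl] := leqP (l g) n; [by left | right; apply: HB'].
have <- : l g = n.+1 by apply/eqP; rewrite eqn_leq lg.
exact: (proj1 (wlen g)).
Qed.

End WordBalls.

Lemma directed_uniform (I : Type) (le : I -> I -> Prop) (G : Type)
    (P : I -> G -> Prop) (B : seq G) : inhabited I ->
  (forall i j k, le i j -> le j k -> le i k) ->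
  (forall i j, exists k, le i k /\ le j k) ->
  (forall g, exists i0, forall i, le i0 i -> P i g) ->
  exists i0, forall i, le i0 i -> forall g, inS B g -> P i g.
Proof.
move=> [i1] tr dir ev; elim: B => [|g B [i0 IH]]; first by exists i1.
have [j Pj] := ev g; have [k [ik jk]] := dir i0 j.
exists k => i ki h [<-|]; first by apply: Pj; apply: tr ki.
by apply: IH; apply: tr ki.
Qed.

Theorem theorem3p1 (R : realType) (G : Type) (Gr : group G) (S : seq G)
    (l : G -> nat) :
  symmetric_set Gr S -> generating Gr S -> is_word_length Gr S l ->
  nuclear_inclusion R Gr (word_dist Gr l) ->
  uniform_embedding R (word_dist Gr l).
Proof.
move=> _ _ wlen [I [le [T [inhI [lexx letr] dir ucpT cvT]]]].
pose d := word_dist Gr l.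
have step n : exists wN : (G -> G -> R) * nat,
    [/\ psd wN.1, (forall s, wN.1 s s = 1),
        (forall s t, (d s t <= n)%N -> 1 - wN.1 s t <= 2^-1 ^+ n) &
        (forall s t, (wN.2 < d s t)%N -> wN.1 s t <= 2^-1)].
  have e0 : 0 < 2^-1 ^+ n :> R by rewrite exprn_gt0 // invr_gt0.
  (* As [d s t] is the length of [s t^-1], the finite ball [B] contains every [s t^-1] with
     [d s t <= n]; pointwise convergence of the net is thus needed at finitely many elements
     only. *)
  have [B HB] := balls_finite wlen n.
  have [i0 Hi0] := directed_uniform B inhI letr dir
    (fun g => cvT _ (@lam_in_Cr R G Gr g) _ e0).
  have [N HN] := ucp_kernel_far (ucpT i0).
  exists (ucp_kernel Gr (T i0), N); split=> //=.
  - exact: ucp_kernel_psd (ucpT i0).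
  - exact: ucp_kernel_diag (ucpT i0).
  - move=> s t dst; apply: ucp_kernel_near; first exact: ltW.
    by apply: Hi0 (lexx i0) _ _; apply: HB.
have [wN HwN] := choice step; have [e esurj] := group_countable wlen.
apply: (@uniform_embedding_of_kernels _ _ _ (fun n => (wN n).1)
  (fun n => (wN n).2) _ _ _ _ e) => // n; by case: (HwN n).
Qed.
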